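(* Let $\Omega$ and $\Delta$ be two locally compact Hausdorff spaces, let $E$ be an essential Banach $C_0(\Omega)$-module, let $F$ be an essential Banach $C_0(\Delta)$-normed module, and let $\theta:E\to F$ be a $\mathbb{C}$-linear map (not assumed to be bounded). Suppose that $\sigma:\Delta_\theta\to\Omega$ is an injection satisfying $\theta(I^E_{\sigma(\nu)})\subseteq K^F_\nu$ for all $\nu\in\Delta_\theta$. (a) If $\Delta$ contains no isolated point, then $\theta$ is bounded. (b) If $\sigma$ sends isolated points in $\Delta_\theta$ to isolated points in $\Omega$, then $\mathfrak{N}_{\theta,\sigma}=\emptyset$ and there exist a finite set $T$ consisting of isolated points of $\Delta$, a bounded linear map $\theta_0:E_{\Omega\setminus\sigma(T)}\to F_{\Delta\setminus T}$, and linear maps $\theta_\nu:\Xi^E_{\sigma(\nu)}\to\Xi^F_\nu$ for all $\nu\in T$, such that $E=E_{\Omega\setminus\sigma(T)}\oplus\bigoplus_{\nu\in T}\Xi^E_{\sigma(\nu)}$, $F=F_{\Delta\setminus T}\oplus\bigoplus_{\nu\in T}\Xi^F_\nu$ and $\theta=\theta_0\oplus\bigoplus_{\nu\in T}\theta_\nu$.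
   Context: Modules are right modules. An essential Banach $C_0(\Omega)$-module $E$ (i.e. $E\cdot C_0(\Omega)$ has dense linear span) is regarded as a unital Banach $C(\Omega_\infty)$-module, where $\Omega_\infty$ is the one-point compactification of $\Omega$. For $S\subseteq\Omega_\infty$ put $K_S:=\{\varphi\in C(\Omega_\infty):\varphi(S)=\{0\}\}$ and $K_S^E:=\overline{E\cdot K_S}$; write $K^E_\omega:=K^E_{\{\omega\}}$. Put $I^E_\omega:=\bigcup_V K^E_V$, the union over all compact neighbourhoods $V$ of $\omega$ in $\Omega_\infty$. The fibre of $E$ at $\omega\in\Omega$ is the Banach space $\Xi^E_\omega:=E/K^E_\omega$. For $e\in E$, $\tilde e(\omega):=e+K^E_\omega\in\Xi^E_\omega$. The same notation is used for $F$ over $\Delta$. For a linear map $\theta:E\to F$, $\tilde\theta(e):=\widetilde{\theta(e)}$, so $\tilde\theta(e)(\nu)=\theta(e)+K^F_\nu$. $\Delta_\theta:=\Delta\setminus\mathfrak{Z}_\theta$, where $\mathfrak{Z}_\theta:=\{\nu\in\Delta:\tilde\theta(e)(\nu)=0\text{ for all }e\in E\}$. Also $\mathfrak{N}_{\theta,\sigma}:=\{\nu\in\Delta_\theta:\theta(K^E_{\sigma(\nu)})\nsubseteq K^F_\nu\}$. For an open subset $\Omega_0\subseteq\Omega$, $E_{\Omega_0}:=K^E_{\Omega\setminus\Omega_0}$, regarded as an essential Banach $C_0(\Omega_0)$-module (similarly for $F$). If $\omega$ is an isolated point of $\Omega$, the fibre $\Xi^E_\omega$ is identified canonically with the submodule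 $E\cdot\chi_{\{\omega\}}$ of $E$ (similarly for $F$); this is the meaning of the direct sum decompositions. $F$ is a Banach $C_0(\Delta)$-normed module if it is an essential Banach $C_0(\Delta)$-module and there is a map $|\cdot|:F\to C_0(\Delta)_+$ such that for $x,y\in F$ and $a\in C_0(\Delta)$: $|x+y|\le|x|+|y|$, $|xa|=|x||a|$, and $\|x\|=\||x|\|$. *)

(* Defs.v *)
From HB Require Import structures.
From mathcomp Require Import all_boot all_order all_algebra finmap.
From mathcomp Require Import generic_quotient ring_quotient complex.
From mathcomp Require Import ring lra.
From mathcomp Require Import all_classical all_reals all_analysis.

Set Implicit Arguments.
Unset Strict Implicit.
Unset Printing Implicit Defensive.

Import Order.TTheory GRing.Theory Num.Theory.
Import numFieldNormedType.Exports.

Local Open Scope classical_set_scope.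
Local Open Scope complex_scope.
Local Open Scope ring_scope.

Section C0.
Context {R : realType} {Omega : topologicalType}.
Implicit Types a b : Omega -> R[i].

(* The regular module [R[i]^o] carries the usual topology of the complex plane. *)
Definition C0 : set (Omega -> R[i]) :=
  [set a | continuous (a : Omega -> R[i]^o) /\
    forall eps : R[i], 0 < eps -> compact [set w | eps <= `|a w|]].

(* On an empty space this is [sup set0 = 0]. *)
Definition supnorm a : R := sup (range (fun w => complex.Re `|a w|)).

End C0.

Definition lspan {R : realType} {E : lmodType R[i]} (A : set E) : set E :=
  [set x | exists (n : nat) (c : 'I_n -> R[i]) (v : 'I_n -> E),
     (forall i, A (v i)) /\ x = \sum_(i < n) c i *: v i].

(* An essential Banach (right) module structure over C_0(Omega) on a Banach
   space; [act e a] is only meaningful for [a] in [C0]. *)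
Record c0module (R : realType) (Omega : topologicalType)
    (E : completeNormedModType R[i]) := C0Module {
  act :> E -> (Omega -> R[i]) -> E;
  act_linearl : forall a, C0 a -> linear (act ^~ a);
  act_linearr : forall e c a b, C0 a -> C0 b ->
    act e (fun w => c * a w + b w) = c *: act e a + act e b;
  act_assoc : forall e a b, C0 a -> C0 b ->
    act (act e a) b = act e (fun w => a w * b w);
  act_contractive : forall e a, C0 a -> `|act e a| <= `|e| * (supnorm a)%:C;
  act_essential :
    closure (lspan [set x | exists e a, C0 a /\ x = act e a]) = [set: E]
}.

(* [nrm] is the map |.| : F -> C_0(Delta)_+. *)
Definition is_c0normed (R : realType) (Delta : topologicalType)
    (F : completeNormedModType R[i]) (N : c0module Delta F) : Prop :=
  exists nrm : F -> Delta -> R[i],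
    [/\ forall x, C0 (nrm x) /\ (forall d, 0 <= nrm x d),
        forall x y d, nrm (x + y) d <= nrm x d + nrm y d,
        forall x a d, C0 a -> nrm (N x a) d = nrm x d * `|a d| &
        forall x, `|x| = (supnorm (nrm x))%:C].

Lemma frac_approx (K : fieldType) (a b k : K) : b + k != 0 ->
  -1 * (a * (b / (b + k))) + a = a * (k / (b + k)).
Proof. by move=> ?; field. Qed.

Lemma frac_simpl (K : numFieldType) (n t s : K) : s != 0 ->
  n * (3 * (t / (3 * s))) = t * (n / s).
Proof. by move=> ?; field. Qed.

Section Module.
Context {R : realType} {Omega : topologicalType}.
Context {E : completeNormedModType R[i]} (M : c0module Omega E).
Local Notation opc := (one_point_compactification Omega).
Implicit Types (phi psi : opc -> R[i]) (S : set opc) (e : E).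

(* The unital C(Omega_oo)-action: phi = (phi - phi(oo)) + phi(oo) 1. *)
Definition actoo e phi : E :=
  M e (fun w => phi (Some w) - phi None) + phi None *: e.

Definition KS S : set (opc -> R[i]) :=
  [set phi | continuous (phi : opc -> R[i]^o) /\ forall x, S x -> phi x = 0].

Definition KE S : set E :=
  closure [set x | exists e phi, KS S phi /\ x = actoo e phi].

Definition IE (w : Omega) : set E :=
  [set e | exists V : set opc,
     [/\ nbhs (Some w : opc) V, compact V & KE V e]].

Local Notation res phi := (fun w : Omega => phi (Some w) - phi None).

Lemma actooE e phi : actoo e phi = M e (res phi) + phi None *: e.
Proof. by []. Qed.

Lemma C0_res phi : continuous (phi : opc -> R[i]^o) -> C0 (res phi).
Proof.
move=> cphi; have cres : continuous (res phi : Omega -> R[i]^o).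
  move=> w; apply: cvgB; last exact: cvg_cst.
  exact: (cvg_comp _ _ (@one_point_compactification_some_continuous _ w)
    (cphi (Some w))).
split=> // eps eps0.
have /cvgrPdist_lt /(_ eps eps0) [W [cW clW] Wsub] := cphi None.
apply: (subclosed_compact _ cW); last first.
  move=> w /= epsw; apply: contrapT => nWw.
  have /= := Wsub (Some w) (or_introl (ex_intro2 _ _ w nWw erefl)).
  rewrite distrC => /(le_lt_trans epsw).
  by rewrite ltxx.
move=> w clw /=; apply: contrapT => /negP; rewrite -real_ltNge ?ger0_real//.
  2: exact: ltW.
move=> wlt; have e0 : 0 < eps - `|res phi w| by rewrite subr_gt0.
have /cvgrPdist_lt /(_ _ e0) nbw := cres w.
have [y [/= epsy /= yw]] := clw _ nbw.
have := le_lt_trans (lerB_dist (res phi y) (res phi w)) _.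
rewrite distrC => /(_ _ yw); rewrite ltrBlDr subrK => /(le_lt_trans epsy).
by rewrite ltxx.
Qed.

Lemma actoo_linearl phi : continuous (phi : opc -> R[i]^o) ->
  linear (actoo ^~ phi).
Proof.
move=> /C0_res cphi c x y; rewrite !actooE (act_linearl M cphi).
by rewrite !scalerDr !scalerA mulrC addrACA.
Qed.

Lemma actoo_linearr e c phi psi :
  continuous (phi : opc -> R[i]^o) -> continuous (psi : opc -> R[i]^o) ->
  actoo e (fun x => c * phi x + psi x) = c *: actoo e phi + actoo e psi.
Proof.
move=> /C0_res cphi /C0_res cpsi; rewrite !actooE.
rewrite (_ : (fun w => _ * _ + _ - _) = fun w => c * res phi w + res psi w); last first.
  by apply/funext => w /=; ring.
by rewrite act_linearr// scalerDl scalerDr scalerA addrACA.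
Qed.

Lemma actoo_assoc e phi psi :
  continuous (phi : opc -> R[i]^o) -> continuous (psi : opc -> R[i]^o) ->
  actoo (actoo e phi) psi = actoo e (fun x => phi x * psi x).
Proof.
move=> cphi cpsi; have [Cphi Cpsi] := (C0_res cphi, C0_res cpsi).
have cmul (f g : opc -> R[i]) : continuous (f : opc -> R[i]^o) ->
    continuous (g : opc -> R[i]^o) ->
    continuous ((fun x => f x * g x) : opc -> R[i]^o).
  by move=> cf cg x; exact: (@cvgM R[i] _ _ _ f g _ _ (cf x) (cg x)).
have csub (f : opc -> R[i]) : continuous (f : opc -> R[i]^o) ->
    continuous ((fun x => f x - f None) : opc -> R[i]^o).
  by move=> cf x; exact: (cvgB (cf x) (cvg_cst _)).
have Cmul : C0 (fun w => res phi w * res psi w).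
  have := C0_res (cmul _ _ (csub _ cphi) (csub _ cpsi)); congr C0.
  by apply/funext => w; ring.
have Cmul2 : C0 (fun w => phi None * res psi w + res phi w * res psi w).
  have := C0_res (cmul _ _ cphi (csub _ cpsi)); congr C0.
  by apply/funext => w; ring.
rewrite !actooE.
rewrite (_ : (fun w => phi (Some w) * _ - _) =
    fun w => psi None * res phi w +
      (phi None * res psi w + res phi w * res psi w)); last first.
  by apply/funext => w; ring.
rewrite !act_linearr// -act_assoc// addrC.
rewrite (addrC (M e (res phi))) (act_linearl M Cpsi) scalerDr scalerA.
by rewrite (mulrC (psi None)) [RHS]addrC -!addrA; congr (_ + _).
Qed.

Lemma supnorm_le (a : Omega -> R[i]) (d : R) :
  0 <= d -> (forall w, `|a w| <= d%:C) -> supnorm a <= d.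
Proof.
move=> d0 ad; rewrite /supnorm.
have [->|/set0P ne] := eqVneq (range (fun w => complex.Re `|a w|)) set0.
  by rewrite sup0.
apply: ge_sup => // _ [w _ <-].
by have := ad w; rewrite lecE => /andP[].
Qed.

Lemma actoo_bound e phi (d : R) : 0 <= d ->
  continuous (phi : opc -> R[i]^o) -> (forall x, `|phi x| <= d%:C) ->
  `|actoo e phi| <= `|e| * (3 * d)%:C.
Proof.
move=> d0 cphi phid; rewrite actooE.
apply: (le_trans (ler_normD _ _)); rewrite normrZ.
apply: (@le_trans _ _ (`|e| * (2 * d)%:C + d%:C * `|e|)); last first.
  by rewrite (mulrC d%:C) -mulrDr -rmorphD/= (_ : 2 * d + d = 3 * d)//; ring.
apply: lerD; last exact: ler_wpM2r.
apply: (le_trans (act_contractive M e (C0_res cphi))).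
apply: ler_wpM2l => //; rewrite lecR; apply: supnorm_le.
  by rewrite mulr_ge0.
move=> w; apply: (le_trans (ler_normB _ _)).
by rewrite mulrDl mul1r rmorphD/= lerD.
Qed.

Lemma continuous_closure (T U : topologicalType) (f : T -> U) (A : set T)
  (B : set U) : continuous f -> (forall a, A a -> closure B (f a)) ->
  forall x, closure A x -> closure B (f x).
Proof.
move=> cf AB x clx V /= fxV.
have [a [Aa /= aV]] := clx _ (cf x _ (nbhs_interior fxV)).
exact: AB Aa V aV.
Qed.

Lemma KE_approx S c e f phi psi : KS S phi -> KS S psi ->
  KE S (c *: actoo e phi + actoo f psi).
Proof.
move=> [cphi phi0] [cpsi psi0] U /= /nbhs_ballP[eps /= eps0 epsU].
have epsE : (complex.Re eps)%:C = eps by rewrite RRe_real// ger0_real ?ltW.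
have d0 : 0 < complex.Re eps by move: eps0; rewrite -epsE ltcR.
pose N : R := complex.Re (`|c *: e| + `|f|).
have NE : N%:C = `|c *: e| + `|f|.
  by rewrite /N RRe_real// ger0_real// addr_ge0.
have N0 : 0 <= N by rewrite -lecR NE addr_ge0.
pose d : R := complex.Re eps / (3 * (N + 1)).
have dpos : 0 < d by rewrite divr_gt0// mulr_gt0// ltr_wpDl.
pose h := fun x : opc => `|phi x| + `|psi x|.
have h0 x : 0 <= h x by rewrite addr_ge0.
have dC0 : 0 < d%:C by rewrite ltcR.
have hd0 x : 0 < h x + d%:C by rewrite ltr_wpDl.
pose u := fun x : opc => h x / (h x + d%:C).
have ch : continuous (h : opc -> R[i]^o).
  move=> x; exact: (@cvgD _ R[i]^o _ _ _ _ _ _ _ (cvg_norm (cphi x)) (cvg_norm (cpsi x))).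
have cu : continuous (u : opc -> R[i]^o).
  move=> x; apply: (@cvgM R[i] _ _ _ h (fun x => (h x + d%:C)^-1) _ _ (ch x)).
  apply: (@cvgV R[i] _ _ _ (fun x => h x + d%:C)); first exact: lt0r_neq0.
  exact: (@cvgD _ R[i]^o _ _ _ _ _ _ _ (ch x) (cvg_cst _)).
have Ku : KS S u.
  by split=> // x Sx; rewrite /u /h phi0// psi0// normr0 addr0 mul0r.
have small chi : continuous (chi : opc -> R[i]^o) ->
    (forall x, `|chi x| <= h x) -> forall g,
    `|actoo g chi - actoo (actoo g chi) u| <= `|g| * (3 * d)%:C.
  move=> cchi chih g; rewrite actoo_assoc// addrC -scaleN1r.
  have cchiu : continuous ((fun x => chi x * u x) : opc -> R[i]^o).
    by move=> x; exact: (@cvgM R[i] _ _ _ chi u _ _ (cchi x) (cu x)).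
  rewrite -actoo_linearr//; apply: actoo_bound; first exact: ltW.
    move=> x; apply: (@cvgD _ R[i]^o _ _ _ _ _ _ _ _ (cchi x)).
    exact: (@cvgM R[i] _ _ _ (fun=> -1) _ _ _ (cvg_cst _) (cchiu x)).
  move=> x.
  have -> : -1 * (chi x * u x) + chi x = chi x * (d%:C / (h x + d%:C)).
    by rewrite /u; apply: frac_approx; rewrite lt0r_neq0.
  rewrite normrM (ger0_norm (divr_ge0 (ltW dC0) (ltW (hd0 x)))).
  rewrite mulrCA mulrC -[leRHS]mul1r; apply: ler_wpM2r; first exact: ltW.
  rewrite ler_pdivrMr// mul1r; apply: (le_trans (chih x)).
  by rewrite lerDl ltW.
exists (actoo (c *: actoo e phi + actoo f psi) u); split.
  by exists (c *: actoo e phi + actoo f psi), u.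
apply: epsU; rewrite -ball_normE /= (actoo_linearl cu) opprD addrACA -scalerBr.
apply: le_lt_trans (ler_normD _ _) _; rewrite normrZ.
apply: (@le_lt_trans _ _ (N%:C * (3 * d)%:C)).
  rewrite NE mulrDl; apply: lerD; last first.
    by apply: small => // x; rewrite lerDr.
  rewrite normrZ -mulrA ler_wpM2l//.
  by apply: small => // x; rewrite lerDl.
rewrite -epsE -rmorphM/= ltcR /d.
rewrite (_ : N * _ = complex.Re eps * (N / (N + 1))); last first.
  by apply: frac_simpl; rewrite lt0r_neq0// ltr_wpDl.
by rewrite gtr_pMr// ltr_pdivrMr ?mul1r ?ltrDl// ltr_wpDl.
Qed.

Definition KEpred S : {pred E} := [pred x | x \in KE S].

Lemma KE_submod_closed S : GRing.submod_closed (KEpred S).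
Proof.
split.
  rewrite !inE; apply: subset_closure; exists 0, (fun=> 0); split.
    by split=> //; exact: (@cst_continuous opc R[i]^o 0).
  have /(_ (-1) 0 0) := @actoo_linearl (fun=> 0) (@cst_continuous opc R[i]^o 0).
  by rewrite scaler0 addr0 scaleN1r addNr.
move=> c x y; rewrite !inE => clx cly.
have cl a : [set x | exists e phi, KS S phi /\ x = actoo e phi] a ->
    KE S (c *: x + a).
  move=> [f [psi [Kpsi ->]]].
  have cf : continuous (fun z : E => c *: z + actoo f psi).
    move=> z; by apply: cvgD; [apply: cvgZl_tmp; exact: cvg_id|exact: cvg_cst].
  apply: (continuous_closure cf) clx.
  by move=> _ [e [phi [Kphi ->]]]; exact: KE_approx.
have cf : continuous (fun z : E => c *: x + z).
  by move=> z; exact: (cvgD (cvg_cst _) cvg_id).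
exact: (continuous_closure cf cl cly).
Qed.

HB.instance Definition _ S :=
  GRing.isSubmodClosed.Build R[i] E (KEpred S) (KE_submod_closed S).

Definition KEsub S : Type := {x : E | x \in KEpred S}.
HB.instance Definition _ S := SubType.on (KEsub S).
HB.instance Definition _ S := [Choice of KEsub S by <:].
HB.instance Definition _ S := [SubChoice_isSubLmodule of KEsub S by <:].

Definition KEquot S : Type := Quotient.quot (KEpred S).
HB.instance Definition _ S := GRing.Zmodule.on (KEquot S).

Definition KEclass S e : KEquot S := (\pi_(Quotient.quot (KEpred S)) e)%qT.

Lemma KEclass_eq S e e' : (KEclass S e == KEclass S e') = (e - e' \in KEpred S).
Proof. by rewrite Quotient.idealrBE. Qed.

Lemma KEclass_repr S (x : KEquot S) : KEclass S (repr x) = x.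
Proof. exact: reprK. Qed.

Lemma KEclassD S : {morph KEclass S : e e' / e + e'}.
Proof. by move=> e e'; rewrite /KEclass raddfD. Qed.

Definition KEquot_scale S c (x : KEquot S) : KEquot S :=
  KEclass S (c *: repr x).

Lemma KEclassZ S c e : KEclass S (c *: e) = KEquot_scale c (KEclass S e).
Proof.
apply/eqP; rewrite KEclass_eq -scalerBr rpredZ// -KEclass_eq.
by rewrite KEclass_repr.
Qed.

Fact KEquot_scaleA S c d (x : KEquot S) :
  KEquot_scale c (KEquot_scale d x) = KEquot_scale (c * d) x.
Proof. by rewrite -(KEclass_repr x) -!KEclassZ scalerA. Qed.

Fact KEquot_scale1 S : left_id 1 (@KEquot_scale S).
Proof. by move=> x; rewrite -(KEclass_repr x) -KEclassZ scale1r. Qed.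

Fact KEquot_scaleDr S : right_distributive (@KEquot_scale S) +%R.
Proof.
move=> c x y; rewrite -(KEclass_repr x) -(KEclass_repr y).
by rewrite -KEclassD -!KEclassZ -KEclassD scalerDr.
Qed.

Fact KEquot_scaleDl S (x : KEquot S) :
  {morph (@KEquot_scale S)^~ x : c d / c + d}.
Proof.
by move=> c d; rewrite -(KEclass_repr x) -!KEclassZ -KEclassD scalerDl.
Qed.

HB.instance Definition _ S := GRing.Zmodule_isLmodule.Build R[i] (KEquot S)
  (@KEquot_scaleA S) (@KEquot_scale1 S) (@KEquot_scaleDr S) (@KEquot_scaleDl S).

(* Only the vector space structure of the fibre is set up. *)
Definition fibre (w : Omega) : lmodType R[i] := KEquot [set Some w].

Definition tilde e (w : Omega) : fibre w := KEclass [set Some w] e.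

(* E_{Omega0} = K^E_{Omega \ Omega0}. *)
Definition restr (Omega0 : set Omega) : lmodType R[i] :=
  KEsub (Some @` ~` Omega0).

(* [restr Omega0] carries the norm of E through this inclusion. *)
Definition restr_emb (Omega0 : set Omega) (x : restr Omega0) : E := sval x.

(* For an isolated point w, the identification e + K^E_w |-> e . chi_{w} of the
   fibre at w with the submodule E . chi_{w}; see [fibre_embE]. *)
Definition fibre_emb (w : Omega) (x : fibre w) : E := M (repr x) \1_[set w].

Lemma C0_indicZ (w : Omega) (c : R[i]) : hausdorff_space Omega ->
  isolated [set: Omega] w -> C0 (fun y => c * \1_[set w] y).
Proof.
move=> hO [_ [V nV]]; rewrite setIT => Vw; subst V.
have nbw x : nbhs x [set y | \1_[set w] y = \1_[set w] x :> R[i]].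
  have [->|xw] := eqVneq x w; first by apply: filterS nV => y ->.
  have : nbhs x (~` [set w]).
    apply: open_nbhs_nbhs; split; last exact/eqP.
    exact/closed_openC/accessible_closed_set1/hausdorff_accessible.
  apply: filterS => y /= yw.
  by rewrite !indicE !memNset//=; exact/eqP.
split.
  move=> x; apply/cvgrPdist_lt => eps eps0.
  by apply: filterS (nbw x) => y /= ->; rewrite subrr normr0.
move=> eps eps0; have [ec|ec] := pselect (eps <= `|c|).
  rewrite (_ : [set _ | _] = [set w]); first exact: compact_set1.
  apply/seteqP; split=> y /=; rewrite indicE.
    case: (boolP (y \in [set w])) => [/set_mem//|_].
    by rewrite mulr0 normr0 => /(lt_le_trans eps0); rewrite ltxx.
  by move=> ->; rewrite mem_set// mulr1.
rewrite (_ : [set _ | _] = set0); first exact: compact0.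
apply/seteqP; split=> y //=; rewrite indicE; case: (_ \in _) => /=.
  by rewrite mulr1 => /ec.
by rewrite mulr0 normr0 => /(lt_le_trans eps0); rewrite ltxx.
Qed.

Lemma C0_indic (w : Omega) : hausdorff_space Omega ->
  isolated [set: Omega] w -> C0 (\1_[set w] : Omega -> R[i]).
Proof.
move=> hO /(C0_indicZ 1 hO); congr C0.
by apply/funext => y; rewrite mul1r.
Qed.

Lemma KE_indic0 (w : Omega) e : hausdorff_space Omega ->
  isolated [set: Omega] w -> KE [set Some w] e -> M e \1_[set w] = 0.
Proof.
move=> hO iw; have Cchi := C0_indic hO iw; have CZ := C0_indicZ _ hO iw.
set chi : Omega -> R[i] := \1_[set w] in Cchi CZ *; move=> cle.
have killed f phi : KS [set Some w] phi -> M (actoo f phi) chi = 0.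
  move=> [cphi phiw].
  rewrite actooE addrC (act_linearl M Cchi) act_assoc//; last exact: C0_res.
  rewrite (_ : (fun y => _ * _) = fun y => - phi None * chi y); last first.
    apply/funext => y; rewrite /chi indicE.
    case: (boolP (y \in [set w])) => [/set_mem ->|_]; last by rewrite !mulr0.
    by rewrite phiw// sub0r.
  rewrite -act_linearr//.
  rewrite (_ : (fun y => _ + _) = fun y => 0 * chi y); last first.
    by apply/funext => y; rewrite mulNr addrN mul0r.
  have := act_linearr M f (-1) (CZ 0) (CZ 0).
  rewrite scaleN1r addNr => M0; rewrite -[RHS]M0; congr (M f _).
  by apply/funext => y; rewrite !mul0r mulr0 addr0.
apply: contrapT => /eqP; rewrite -normr_gt0; set v := `|_| => v0.
pose N := `|supnorm chi|%:C.
have N0 : 0 <= N by rewrite lecR.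
have N10 : 0 < N + 1 by rewrite ltr_wpDl.
have /cle [_ [[f [phi [Kphi ->]]]]] := nbhsx_ballx e _ (divr_gt0 v0 N10).
rewrite -ball_normE /= ltr_pdivlMr// => ltv.
suff /le_lt_trans /(_ ltv) : v <= `|e - actoo f phi| * (N + 1).
  by rewrite ltxx.
have -> : v = `|M (e - actoo f phi) chi|.
  by rewrite addrC -scaleN1r (act_linearl M Cchi) killed// scaler0 add0r.
apply: (le_trans (act_contractive M _ Cchi)); apply: ler_wpM2l => //.
by rewrite ler_wpDr// lecR ler_norm.
Qed.

Lemma fibre_embE (w : Omega) e : hausdorff_space Omega ->
  isolated [set: Omega] w -> fibre_emb (tilde e w) = M e \1_[set w].
Proof.
move=> hO iw; have Cchi := C0_indic hO iw.
have : repr (tilde e w) - e \in KEpred [set Some w].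
  by rewrite -KEclass_eq KEclass_repr.
rewrite inE => /(KE_indic0 hO iw) /eqP.
rewrite addrC -scaleN1r (act_linearl M Cchi) scaleN1r addrC subr_eq0.
by move=> /eqP.
Qed.

(* The canonical map from the external direct sum of E_{Omega \ w(I)} and the
   fibres at the w(i) into E; E is their direct sum iff it is bijective. *)
Definition dsum_emb (I : finType) (w : I -> Omega)
    (p : restr (~` range w) * (forall i, fibre (w i))) : E :=
  restr_emb p.1 + \sum_i fibre_emb (p.2 i).

End Module.

Definition bounded_map (R : realType) (E F : normedModType R[i])
    (theta : E -> F) : Prop :=
  exists C : R, forall e, `|theta e| <= C%:C * `|e|.

Section Support.
Context {R : realType} {Omega Delta : topologicalType}.
Context {E F : completeNormedModType R[i]}.
Variables (M : c0module Omega E) (N : c0module Delta F).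
Variable theta : E -> F.

Definition Zset : set Delta :=
  [set nu | forall e, tilde N (theta e) nu = 0].

Definition Dset : set Delta := [set: Delta] `\` Zset.

Definition Nset (sigma : Dset -> Omega) : set Dset :=
  [set nu | ~ (theta @` KE M [set Some (sigma nu)] `<=`
               KE N [set Some (val nu)])].

End Support.

(* Main.v *)
From HB Require Import structures.
Require Import Defs.
From mathcomp Require Import all_boot all_order all_algebra finmap complex.
From mathcomp Require Import all_classical all_reals all_analysis.
From mathcomp Require Import ring.

Import Order.TTheory GRing.Theory Num.Theory.
Import numFieldNormedType.Exports.
Local Open Scope classical_set_scope.
Local Open Scope complex_scope.
Local Open Scope ring_scope.

(* Write |theta e|(nu) for the value at nu of the C_0(Delta)-valued norm of
   theta e; it vanishes exactly when theta e lies in K^F_nu. A gliding hump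
   shows that |theta e|(nu) <= C ||e|| for all nu outside a finite set: otherwise
   one finds infinitely many nu_n whose images sigma(nu_n) have pairwise disjoint
   neighbourhoods and x_n of norm at most 2^-n with |theta x_n|(nu_n) > n; the
   sum e of suitable cut-offs of the x_n agrees with x_n near sigma(nu_n), so
   |theta e|(nu_n) > n for all n by locality, although |theta e| is bounded by
   the norm of theta e. Since |theta e| is continuous, the exceptional points may
   be taken isolated in Delta. Off these points, continuity of e |-> |theta e|(nu)
   and density of I^E in K^E give theta(K^E_{sigma(nu)}) in K^F_nu; at these
   points sigma(nu) is isolated, so that I^E and K^E agree there. *)

(** * Real and complex moduli *)

Section ComplexReal.
Local Set Implicit Arguments.
Local Unset Strict Implicit.
Context {R : realType}.
Implicit Types (x : R[i]) (r : R).

Lemma ge0_ReK x : 0 <= x -> (complex.Re x)%:C = x.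
Proof. by move=> x0; rewrite RRe_real// ger0_real. Qed.

Lemma Re_norm_ge0 (V : normedZmodType R[i]) (v : V) : 0 <= complex.Re `|v|.
Proof. by rewrite -lecR ge0_ReK ?normr_ge0. Qed.

Lemma normC_real r : `|r%:C| = `|r|%:C :> R[i].
Proof. by rewrite normc_def/= expr0n addr0 sqrtr_sqr. Qed.

Lemma continuous_real_complex : continuous (fun r => r%:C : R[i]^o).
Proof.
move=> r; apply/cvgrPdist_lt => eps eps0.
have e0 : 0 < complex.Re eps by rewrite -ltcR ge0_ReK// ltW.
have /cvgrPdist_lt /(_ _ e0) : r' @[r' --> r] --> r by exact: cvg_id.
apply: filterS => s rs; rewrite -rmorphB/= normC_real -(ge0_ReK (ltW eps0)).
by rewrite ltcR.
Qed.

Lemma continuous_Re_norm (T : topologicalType) (a : T -> R[i]) :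
  continuous (a : T -> R[i]^o) -> continuous (fun t => complex.Re `|a t|).
Proof.
move=> ca t; apply/cvgrPdist_lt => eps eps0.
have e0 : 0 < eps%:C by rewrite ltcR.
have /cvgrPdist_lt /(_ _ e0) := ca t; apply: filterS => s.
move=> /(le_lt_trans (ler_dist_dist _ _)).
rewrite -(@ge0_ReK `|a t|)// -(@ge0_ReK `|a s|)// -rmorphB/= normC_real ltcR.
by [].
Qed.

End ComplexReal.

(** * Functions vanishing at infinity, and cutoffs on the one-point compactification *)

Section C0Facts.
Local Set Implicit Arguments.
Local Unset Strict Implicit.
Context {R : realType} {X : topologicalType}.
Implicit Types a b : X -> R[i].
Local Notation opc := (one_point_compactification X).

(** Since [sup] of an unbounded set is 0 by convention, boundedness of [a] has to come first: [a] is
    bounded on the compact set where its modulus is at least 1, and by 1 elsewhere. *)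
Lemma norm_le_supnorm {a} : C0 a -> forall x, `|a x| <= (supnorm a)%:C.
Proof.
move=> [ca tail] x.
have ubd : has_ubound (range (fun w => complex.Re `|a w|)).
  have K1 := tail 1 ltr01.
  have /compact_bounded [B [_ HB]] := continuous_compact
    (continuous_subspaceT (continuous_Re_norm ca)) K1.
  exists (`|B| + 1) => _ [w _ <-].
  have [w1|w1] := pselect (1 <= `|a w|).
    have -> : complex.Re `|a w| = `|complex.Re `|a w| |.
      by rewrite [RHS]ger0_norm// Re_norm_ge0.
    apply: (HB (`|B| + 1)); last by exists w.
    by rewrite (le_lt_trans (ler_norm _))// ltrDl.
  have : `|a w| < 1 by rewrite real_ltNge ?ger0_real//; exact/negP.
  rewrite -(ge0_ReK (normr_ge0 (a w))) ltcR => /ltW h; rewrite (le_trans h)//.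
  by rewrite lerDr.
rewrite -(ge0_ReK (normr_ge0 (a x))) lecR; apply: (ub_le_sup ubd).
by exists x.
Qed.

(** For [a] in [C0] this is the element a + c of the unitization of C_0(X), seen as a function on
    the compactification. *)
Definition extend a (c : R[i]) : opc -> R[i] :=
  fun x => if x is Some w then a w + c else c.

Lemma extend_continuous a c : C0 a -> continuous (extend a c : opc -> R[i]^o).
Proof.
move=> [ca tail] [w|].
  have : (fun y => a y + c : R[i]^o) @ w --> (a w + c : R[i]^o).
    exact: cvgD (ca w) (cvg_cst _).
  exact.
apply: (iffRL (@cvgrPdist_lt _ R[i]^o _ (nbhs (None : opc)) (nbhs_filter _) _ _)).
move=> eps eps0.
have ceps : closed [set w | eps <= `|a w|].
  rewrite (_ : [set w | _] =
      (fun t => complex.Re `|a t|) @^-1` [set r | complex.Re eps <= r]).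
    apply: preimage_closed; last exact: closed_ge.
    by move=> t _; exact: (continuous_Re_norm ca).
  apply/seteqP; split => w /=; rewrite -lecR !ge0_ReK//; exact: ltW.
exists [set w | eps <= `|a w|]; first by split; [exact: tail|].
move=> _ [[w nw <-]|->] /=; last by rewrite subrr normr0.
rewrite opprD addrCA subrr addr0 normrN.
by rewrite real_ltNge ?ger0_real//; [exact/negP | exact: ltW].
Qed.

(** The extensions by 0 at infinity reduce this to algebra of continuous functions on the
    compactification, and [C0_res] brings the result back. *)
Lemma C0_comb a b c : C0 a -> C0 b -> C0 (fun w => c * a w + b w).
Proof.
move=> Ca Cb; have cc : continuous
    ((fun x => c * extend a 0 x + extend b 0 x) : opc -> R[i]^o).
  move=> x; apply: (@cvgD _ R[i]^o _ _ _ _ _ _ _ _ (@extend_continuous b 0 Cb x)).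
  exact: (@cvgM R[i] _ _ _ (fun=> c) _ _ _ (cvg_cst _) (@extend_continuous a 0 Ca x)).
have := C0_res cc; congr C0; apply/funext => w /=; ring.
Qed.

Lemma C0_mul_continuous a (b : opc -> R[i]) :
  C0 a -> continuous (b : opc -> R[i]^o) -> C0 (fun w => a w * b (Some w)).
Proof.
move=> Ca cb; have cc : continuous
    ((fun x => extend a 0 x * b x) : opc -> R[i]^o).
  move=> x; exact: (@cvgM R[i] _ _ _ _ _ _ _ (@extend_continuous a 0 Ca x) (cb x)).
have := C0_res cc; congr C0; apply/funext => w /=; ring.
Qed.

Hypotheses (hX : hausdorff_space X) (lX : locally_compact [set: X]).

Lemma opc_hausdorff : hausdorff_space opc.
Proof. exact: one_point_compactification_hausdorff. Qed.

Lemma opc_closed_nbhs (x : opc) (W : set opc) : nbhs x W ->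
  exists V, [/\ nbhs x V, closed V & V `<=` W].
Proof.
move=> xW; have [V xV VW] := compact_regular opc_hausdorff
  one_point_compactification_compact (@filterT _ (nbhs x) _) xW.
exists (closure V); split => //; last exact: closed_closure.
exact: filterS (@subset_closure _ V) xV.
Qed.

(** Urysohn's lemma: the compactification is compact Hausdorff, hence normal. *)
Lemma opc_cutoff (x : opc) (W : set opc) : nbhs x W ->
  exists (V : set opc) (f : opc -> R[i]), [/\ nbhs x V, compact V,
    continuous (f : opc -> R[i]^o), forall y, 0 <= f y <= 1 &
    (forall y, V y -> f y = 1) /\ (forall y, ~ W y -> f y = 0)].
Proof.
move=> xW; have [V [xV clV VW]] := opc_closed_nbhs (nbhs_interior xW).
have nopc := compact_normal opc_hausdorff one_point_compactification_compact.
(* [W] need not be open, so its interior is used to obtain a closed complement. *)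
have clW : closed (~` W°) by apply: open_closedC; exact: open_interior.
have dis : ~` W° `&` V = set0.
  by apply/disjoints_subset => y /= nWy Vy; exact: nWy (VW _ Vy).
have := (@normal_separatorP R opc).1 nopc _ _ clW clV dis.
move=> /(@uniform_separatorP _ R)[f [cf f01 f0 f1]].
exists V, (fun y => (f y)%:C); split => //.
- exact: subclosed_compact clV one_point_compactification_compact _.
- by move=> y; apply: continuous_comp; [exact: cf|exact: continuous_real_complex].
- move=> y; have /= := f01 (f y) (ex_intro2 _ _ y I erefl).
  by rewrite in_itv/= !lecR.
split=> y Sy; first by rewrite (f1 (f y))//; exists y.
rewrite (f0 (f y))//; exists y => //= /interior_subset; exact: Sy.
Qed.

End C0Facts.

(** * Calculus of the module action, gluing of series, and density of I^E in K^E *)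

Section ModuleFacts.
Local Set Implicit Arguments.
Local Unset Strict Implicit.
Context {R : realType} {X : topologicalType} {E : completeNormedModType R[i]}.
Variable M : c0module X E.
Local Notation opc := (one_point_compactification X).
Implicit Types (e : E) (a b : X -> R[i]) (phi psi : opc -> R[i]).

Lemma C0_0 : C0 ((fun=> 0) : X -> R[i]).
Proof.
have := @C0_res _ X _ (@cst_continuous opc R[i]^o 0).
by congr C0; apply/funext => w; rewrite /= subrr.
Qed.

Lemma act_fun0 e : M e (fun=> 0) = 0.
Proof.
have := act_linearr M e (-1) C0_0 C0_0; rewrite scaleN1r addNr => <-.
by congr (M e _); apply/funext => w; rewrite mulr0 addr0.
Qed.

Lemma act_0 a : C0 a -> M 0 a = 0.
Proof.
by move=> Ca; have := act_linearl M Ca (-1) 0 0; rewrite scaler0 addr0 scaleN1r addNr.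
Qed.

Lemma actD (x y : E) a : C0 a -> M (x + y) a = M x a + M y a.
Proof. by move=> Ca; have := act_linearl M Ca 1 x y; rewrite !scale1r. Qed.

Lemma actZ c (x : E) a : C0 a -> M (c *: x) a = c *: M x a.
Proof. by move=> Ca; have := act_linearl M Ca c x 0; rewrite act_0// !addr0. Qed.

Lemma actN (x : E) a : C0 a -> M (- x) a = - M x a.
Proof. by move=> Ca; rewrite -scaleN1r actZ// scaleN1r. Qed.

Lemma act_suml (I : Type) (r : seq I) (z : I -> E) a : C0 a ->
  M (\sum_(i <- r) z i) a = \sum_(i <- r) M (z i) a.
Proof.
move=> Ca; elim: r => [|i r IH]; first by rewrite !big_nil act_0.
by rewrite !big_cons actD// IH.
Qed.

(** The two conclusions are proved together because [act_linearr] requires the partial sums to be in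
    [C0]. *)
Lemma act_sumr (I : Type) (r : seq I) e (b : I -> X -> R[i]) :
  (forall i, C0 (b i)) ->
  C0 (fun t => \sum_(i <- r) b i t) /\
  M e (fun t => \sum_(i <- r) b i t) = \sum_(i <- r) M e (b i).
Proof.
move=> Cb; elim: r => [|i r [IH1 IH2]].
  have -> : (fun t => \sum_(i <- [::]) b i t) = fun=> 0.
    by apply/funext => y; rewrite big_nil.
  by rewrite big_nil act_fun0; split=> //; exact: C0_0.
have -> : (fun t => \sum_(j <- i :: r) b j t) =
    fun t => 1 * b i t + \sum_(j <- r) b j t.
  by apply/funext => y; rewrite big_cons mul1r.
by rewrite big_cons act_linearr// scale1r IH2; split=> //; exact: C0_comb.
Qed.

Lemma actoo_extend e a c : C0 a -> actoo M e (extend a c) = M e a + c *: e.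
Proof.
move=> Ca; rewrite actooE; congr (M e _ + _); apply/funext => w /=.
by rewrite addrK.
Qed.

Lemma actoo_cst e c : actoo M e (fun=> c) = c *: e.
Proof.
rewrite actooE; have -> : (fun w : X => c - c) = fun=> 0.
  by apply/funext => w; rewrite subrr.
by rewrite act_fun0 add0r.
Qed.

Lemma actooB e phi psi :
  continuous (phi : opc -> R[i]^o) -> continuous (psi : opc -> R[i]^o) ->
  actoo M e phi - actoo M e psi = actoo M e (fun x => phi x - psi x).
Proof.
move=> cphi cpsi; rewrite addrC -scaleN1r -actoo_linearr//; congr actoo.
by apply/funext => x; rewrite mulN1r addrC.
Qed.

Lemma mem_KEpred S e : (e \in KEpred M S) = `[< KE M S e >].
Proof. by []. Qed.

Lemma KE_actoo S e phi : KS S phi -> KE M S (actoo M e phi).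
Proof. by move=> Sphi; apply: subset_closure; exists e, phi. Qed.

Lemma KE_subset S T : S `<=` T -> KE M T `<=` KE M S.
Proof.
move=> ST; apply: closureS => _ [e [phi [[cphi phi0] ->]]].
by exists e, phi; split=> //; split=> // x /ST; exact: phi0.
Qed.

Lemma KE_D S (x y : E) : KE M S x -> KE M S y -> KE M S (x + y).
Proof.
move=> /asboolP; rewrite -mem_KEpred => Sx /asboolP; rewrite -mem_KEpred => Sy.
by apply/asboolP; rewrite -mem_KEpred rpredD.
Qed.

Lemma KE_sum S (I : Type) (r : seq I) (P : pred I) (z : I -> E) :
  (forall i, P i -> KE M S (z i)) -> KE M S (\sum_(i <- r | P i) z i).
Proof.
move=> Sz; apply/asboolP; rewrite -mem_KEpred rpred_sum// => i Pi.
by rewrite mem_KEpred; apply/asboolP; exact: Sz.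
Qed.

Lemma tilde_eqP (x y : E) w : tilde M x w = tilde M y w <-> KE M [set Some w] (x - y).
Proof.
rewrite (rwP eqP) /tilde KEclass_eq mem_KEpred.
by split=> /asboolP.
Qed.

Lemma tilde_eq0 (x : E) w : tilde M x w = 0 <-> KE M [set Some w] x.
Proof.
have -> : 0 = tilde M 0 w by rewrite /tilde /KEclass raddf0.
by rewrite tilde_eqP subr0.
Qed.

Lemma tilde_linear c (x y : E) w :
  tilde M (c *: x + y) w = c *: tilde M x w + tilde M y w.
Proof. by rewrite /tilde KEclassD KEclassZ. Qed.

(** Weierstrass' test: the Cauchy criterion for the geometric series passes to [u], and [E] is
    complete. *)
Lemma cvg_geometric_majorant (u : E ^nat) (c : R) :
  (forall n, `|u n| <= (geometric c 2^-1 n)%:C) -> cvgn (series u).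
Proof.
move=> uc; apply: cauchy_cvg; apply/cauchy_seriesP => eps eps0.
have e0 : 0 < complex.Re eps by rewrite -ltcR ge0_ReK// ltW.
have /cvg_cauchy/cauchy_seriesP/(_ _ e0) : cvgn (series (geometric c (2^-1 : R))).
  by apply: is_cvg_geometric_series; rewrite ger0_norm ?invr_ge0// invf_lt1// ltr1n.
apply: filterS => -[m n] /=; rewrite -ltcR (ge0_ReK (ltW eps0)).
apply: le_lt_trans; apply: (le_trans (ler_norm_sum _ _ _)).
apply: le_trans (_ : (\sum_(m <= k < n) geometric c 2^-1 k)%:C <= _).
  by rewrite rmorph_sum/=; apply: ler_sum => k _; exact: uc.
by rewrite lecR ler_norm.
Qed.

Hypotheses (hX : hausdorff_space X) (lX : locally_compact [set: X]).

(* The cutoffs have pairwise disjoint supports, so near [Some (w n)] only the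
   [n]-th term of the series contributes. *)
Lemma disjoint_glue (w : nat -> X) (W : nat -> set opc) (x : nat -> E) :
  (forall n, nbhs (Some (w n) : opc) (W n)) ->
  (forall m n, m != n -> W m `&` W n = set0) ->
  (forall n, `|x n| <= (2^-1 ^+ n)%:C) ->
  exists e, forall n, IE M (w n) (e - x n).
Proof.
move=> nW dW bx.
have /choice [Vf HVf] : forall n, exists Vf : set opc * (opc -> R[i]),
    [/\ nbhs (Some (w n) : opc) Vf.1, compact Vf.1,
    continuous (Vf.2 : opc -> R[i]^o), forall y, 0 <= Vf.2 y <= 1 &
    (forall y, Vf.1 y -> Vf.2 y = 1) /\ (forall y, ~ W n y -> Vf.2 y = 0)].
  by move=> n; have [V [f H]] := @opc_cutoff R X hX lX _ _ (nW n); exists (V, f).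
pose V n := (Vf n).1; pose f n := (Vf n).2.
have nV n : nbhs (Some (w n) : opc) (V n) by have [] := HVf n.
have cV n : compact (V n) by have [] := HVf n.
have cf n : continuous (f n : opc -> R[i]^o) by have [] := HVf n.
have f01 n y : 0 <= f n y <= 1 by have [_ _ _ + _] := HVf n; exact.
have f1 n y : V n y -> f n y = 1 by have [_ _ _ _ [+ _]] := HVf n; exact.
have f0 n y : ~ W n y -> f n y = 0 by have [_ _ _ _ [_ +]] := HVf n; exact.
have VW n : V n `<=` W n.
  move=> y Vy; apply: contrapT => /f0; rewrite f1// => /eqP.
  by rewrite oner_eq0.
pose u n := actoo M (x n) (f n).
have : cvgn (series u).
  (* The constant 3 is the one of [actoo_bound]. *)
  apply: (@cvg_geometric_majorant _ 3) => n.
  apply: (@le_trans _ _ (`|x n| * (3 * 1)%:C)).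
    apply: actoo_bound => // y; have /andP[h0 h1] := f01 n y.
    by rewrite ger0_norm.
  rewrite mulr1 mulrC /= rmorphM/=; apply: ler_wpM2l => //.
  by rewrite lecR.
move=> /cvg_ex [e ce]; exists e => n; exists (V n); split => //.
have cen : (fun N => series u N - x n) @ \oo --> e - x n.
  by exact: (cvgB ce (cvg_cst _)).
(* As K^E is closed, it is enough to treat the partial sums that contain the term of index [n]. *)
apply: (@closed_cvg _ _ _ _ (fun N => series u N - x n) (KE M (V n))
  (@closed_closure _ _) _ _ cen).
near=> N.
have nN : (n < N)%N by near: N; exact: nbhs_infty_gt.
change (KE M (V n) (series u N - x n)).
(* On [V n] the cutoffs of the other terms vanish, because their supports avoid [W n], and [f n] - 1
   vanishes too. *)
have -> : series u N - x n =
    \sum_(i < N | i != Ordinal nN) u i + (u n - x n).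
  by rewrite /series/= big_mkord (bigD1 (Ordinal nN))//= addrA [u n + _]addrC.
apply: KE_D.
  apply: KE_sum => i ne; apply: KE_actoo; split=> // y Vy; apply: f0 => Wy.
  have : (W i `&` W n) y by split => //; exact: VW.
  by rewrite dW.
rewrite -[x n]scale1r -(actoo_cst (x n) 1) actooB//; last first.
  exact: (@cst_continuous opc R[i]^o).
apply: KE_actoo; split; last by move=> y Vy; rewrite f1// subrr.
by move=> y; exact: (cvgB (cf n y) (cvg_cst _)).
Unshelve. all: by end_near. Qed.

(** First approximate [e] by an element g phi with phi vanishing at [w], then replace phi by phi (1
    - f), where the cutoff f is 1 near [w] and supported where phi is small. *)
Lemma IE_dense w e (eps : R) : KE M [set Some w] e -> 0 < eps ->
  exists u, IE M w u /\ `|e - u| < eps%:C.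
Proof.
move=> Ke eps0; have e20 : 0 < (eps / 2)%:C by rewrite ltcR divr_gt0.
have [_ [[g [phi [[cphi phiw] ->]]]]] := Ke _ (nbhsx_ballx e _ e20).
rewrite -ball_normE /= => close.
pose B : R := complex.Re `|g|.
have B0 : 0 <= B by exact: Re_norm_ge0.
have BE : B%:C = `|g| by rewrite ge0_ReK.
(* By [actoo_bound], removing phi f costs at most 3 [r] [B], which is at most half of [eps]; the
   added 1 covers [B] = 0. *)
pose r : R := eps / 2 / (3 * (B + 1)).
have r0 : 0 < r by rewrite !divr_gt0// mulr_gt0// ltr_wpDl.
have rC0 : 0 < r%:C by rewrite ltcR.
have nW : nbhs (Some w : opc) [set y | `|phi y| <= r%:C].
  have /cvgrPdist_lt/(_ _ rC0) := cphi (Some w).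
  apply: filterS => y /=; rewrite phiw// sub0r normrN; exact: ltW.
have [V [f [nV cV cf f01 [f1 f0]]]] := @opc_cutoff R X hX lX _ _ nW.
have cphif : continuous ((fun y => phi y * f y) : opc -> R[i]^o).
  by move=> y; exact: (@cvgM R[i] _ _ _ phi f _ _ (cphi y) (cf y)).
exists (actoo M g (fun y => phi y - phi y * f y)); split.
  exists V; split => //; apply: KE_actoo; split; last first.
    by move=> y Vy; rewrite f1// mulr1 subrr.
  by move=> y; exact: (cvgB (cphi y) (cphif y)).
rewrite -actooB// opprB addrCA addrC.
apply: (le_lt_trans (ler_normD _ _)).
rewrite [eps]splitr rmorphD/=; apply: ltr_leD => //.
apply: (@le_trans _ _ (`|g| * (3 * r)%:C)).
  apply: actoo_bound => //; first exact: ltW.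
  move=> y; have /andP[fy0 fy1] := f01 y.
  have [Wy|Wy] := pselect (`|phi y| <= r%:C).
    rewrite normrM (ger0_norm fy0) -[leRHS]mulr1.
    by apply: ler_pM.
  by rewrite f0// mulr0 normr0 ltW.
rewrite -BE -rmorphM/= lecR.
rewrite /r; set h := eps / 2.
have h0 : 0 <= h by rewrite divr_ge0// ltW.
have -> : B * (3 * (h / (3 * (B + 1)))) = h * (B / (B + 1)).
  by field; rewrite lt0r_neq0// ltr_wpDl.
by rewrite ler_piMr// ler_pdivrMr ?mul1r ?lerDl// ltr_wpDl.
Qed.

End ModuleFacts.

(** * Splitting off the fibres at finitely many isolated points *)

Section DirectSum.
Local Set Implicit Arguments.
Local Unset Strict Implicit.
Context {R : realType} {X : topologicalType} {E : completeNormedModType R[i]}.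
Variable M : c0module X E.
Hypothesis hX : hausdorff_space X.
Local Notation opc := (one_point_compactification X).
Local Notation ind w := (\1_[set w] : X -> R[i]).
Implicit Types e : E.

(** The difference is [e] acted on by 1 - [a], which vanishes on [S]. *)
Lemma KE_sub_act e (a : X -> R[i]) (S : set X) : C0 a ->
  (forall w, S w -> a w = 1) -> KE M (Some @` S) (e - M e a).
Proof.
move=> Ca a1; have Cna : C0 (fun w => - a w).
  have := C0_comb (-1) Ca C0_0; congr C0.
  by apply/funext => w; rewrite mulN1r addr0.
have MN : M e (fun w => - a w) = - M e a.
  have := act_linearr M e (-1) Ca C0_0; rewrite act_fun0 addr0 scaleN1r => <-.
  by congr (M e _); apply/funext => w; rewrite mulN1r addr0.
have -> : e - M e a = actoo M e (extend (fun w => - a w) 1).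
  by rewrite actoo_extend// MN scale1r addrC.
apply: KE_actoo; split; first exact: extend_continuous.
by move=> _ [w Sw <-] /=; rewrite a1// addNr.
Qed.

Lemma KE_sub_act_indic e w : isolated [set: X] w ->
  KE M [set Some w] (e - M e (ind w)).
Proof.
move=> iw; rewrite -image_set1; apply: KE_sub_act; first exact: C0_indic.
by move=> _ ->; rewrite indicE mem_set.
Qed.

Lemma tilde_act_indic e w : isolated [set: X] w ->
  tilde M (M e (ind w)) w = tilde M e w.
Proof. by move=> iw; apply/esym/tilde_eqP; exact: KE_sub_act_indic. Qed.

Lemma act_indic_indic e w v : isolated [set: X] w -> isolated [set: X] v ->
  M (M e (ind w)) (ind v) = if w == v then M e (ind w) else 0.
Proof.
move=> iw iv; rewrite act_assoc; [|exact: C0_indic..].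
case: eqVneq => [->|wv].
  congr (M e _); apply/funext => x; rewrite indicE.
  by case: (_ \in _); rewrite ?mulr1 ?mulr0.
rewrite -(act_fun0 M e); congr (M e _); apply/funext => x; rewrite !indicE.
have [xw|/eqP xw] := eqVneq x w; last by rewrite [x \in [set w]]memNset ?mul0r.
by rewrite [x \in [set v]]memNset ?mulr0// xw => /= /eqP; rewrite (negbTE wv).
Qed.

Variables (I : finType) (w : I -> X).
Hypotheses (w_inj : injective w) (w_iso : forall i, isolated [set: X] (w i)).

Lemma KE_sub_sum_act_indic e :
  KE M (Some @` range w) (e - \sum_i M e (ind (w i))).
Proof.
have [Ca <-] := act_sumr M (index_enum I) e (fun i => C0_indic hX (w_iso i)).
apply: KE_sub_act => // _ [i _ <-].
rewrite (bigD1 i)//= indicE mem_set// big1 ?addr0// => j ji.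
by rewrite indicE memNset//= => /w_inj ij; rewrite ij eqxx in ji.
Qed.

(** Multiplication by the indicator at [w j] extracts the component of index [j], which yields
    injectivity of [dsum_emb]. *)
Lemma act_dsum_emb (p : restr M (~` range w) * (forall i, fibre M (w i))) j :
  M (dsum_emb p) (ind (w j)) = fibre_emb (p.2 j).
Proof.
have Cj := C0_indic hX (w_iso j).
rewrite /dsum_emb actD// act_suml// (KE_indic0 hX)//; last first.
  have /asboolP := svalP p.1; apply: KE_subset => _ ->.
  by exists (w j) => //; rewrite setCK; exists j.
rewrite add0r (bigD1 j)//= big1 => [|i ij].
  by rewrite /fibre_emb act_indic_indic// eqxx addr0.
by rewrite /fibre_emb act_indic_indic// (inj_eq w_inj) (negbTE ij).
Qed.

Lemma dsum_emb_bij : bijective (@dsum_emb R X E M I w).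
Proof.
have memK e : e - \sum_i M e (ind (w i)) \in KEpred M (Some @` ~` ~` range w).
  by rewrite setCK mem_KEpred; apply/asboolP; exact: KE_sub_sum_act_indic.
(* The inverse subtracts all the e chi_{w i} and keeps the classes of [e] in the fibres. *)
pose g e : restr M (~` range w) * (forall i, fibre M (w i)) :=
  (exist (fun x => is_true (x \in KEpred M _)) _ (memK e), fun i => tilde M e (w i)).
exists g => [p|e]; last first.
  rewrite /dsum_emb /restr_emb /=.
  under [X in _ + X]eq_bigr do rewrite fibre_embE//.
  by rewrite subrK.
have Ep i := act_dsum_emb p i; case: p Ep => p q /= Ep.
congr pair.
  apply: val_inj; rewrite /= (eq_bigr _ (fun i _ => Ep i)).
  by rewrite /dsum_emb/= addrK.
apply: functional_extensionality_dep => i.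
by rewrite -tilde_act_indic// Ep tilde_act_indic// /tilde KEclass_repr.
Qed.

End DirectSum.

(** * Pointwise norms, and K^F described by their vanishing *)

Section Normed.
Local Set Implicit Arguments.
Local Unset Strict Implicit.
Context {R : realType} {X : topologicalType} {F : completeNormedModType R[i]}.
Variables (N : c0module X F) (nrm : F -> X -> R[i]).
Hypotheses (hX : hausdorff_space X) (lX : locally_compact [set: X]).
Hypotheses (nrm_C0 : forall x, C0 (nrm x) /\ (forall d, 0 <= nrm x d))
  (nrm_triangle : forall x y d, nrm (x + y) d <= nrm x d + nrm y d)
  (nrm_act : forall x a d, C0 a -> nrm (N x a) d = nrm x d * `|a d|)
  (norm_nrm : forall x, `|x| = (supnorm (nrm x))%:C).
Local Notation opc := (one_point_compactification X).
Implicit Types (x y : F) (d : X).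

Lemma nrm_ge0 x d : 0 <= nrm x d.
Proof. by have [_] := nrm_C0 x; exact. Qed.

Lemma nrm_le_norm x d : nrm x d <= `|x|.
Proof.
have [Cx _] := nrm_C0 x; rewrite norm_nrm -[leLHS]ger0_norm ?nrm_ge0//.
exact: norm_le_supnorm.
Qed.

Lemma norm_le_nrm x (r : R) :
  0 <= r -> (forall d, nrm x d <= r%:C) -> `|x| <= r%:C.
Proof.
move=> r0 xr; rewrite norm_nrm lecR; apply: supnorm_le => // d.
by rewrite ger0_norm// nrm_ge0.
Qed.

(** [nrm_act] covers only functions in [C0]. A cutoff [b] in [C0] with value 1 at [d] leaves the
    norm at [d] unchanged, and b phi is in [C0]. *)
Lemma nrm_actoo x (phi : opc -> R[i]) d : continuous (phi : opc -> R[i]^o) ->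
  nrm (actoo N x phi) d = nrm x d * `|phi (Some d)|.
Proof.
move=> cphi.
have nd : @nbhs _ opc (Some d) (range Some).
  by apply: one_point_compactification_some_nbhs; exact: filterT.
have [V [f [nV _ cf _ [f1 f0]]]] := @opc_cutoff R X hX lX _ _ nd.
have fN : f None = 0 by apply: f0 => -[].
pose b d := f (Some d).
have Cb : C0 b.
  by have := C0_res cf; congr C0; apply/funext => y; rewrite fN subr0.
have bd : b d = 1 by apply: f1; exact: (nbhs_singleton nV).
have nrmb y : nrm (N y b) d = nrm y d by rewrite nrm_act// bd normr1 mulr1.
have Cphi := C0_res cphi.
have Cbphi : C0 (fun w => b w * phi (Some w)) by exact: C0_mul_continuous.
have Cresb : C0 (fun w => (phi (Some w) - phi None) * b w).
  have := C0_comb (- phi None) Cb Cbphi; congr C0.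
  by apply/funext => w; ring.
rewrite -nrmb actooE actD// actZ// act_assoc// addrC -act_linearr//.
rewrite (_ : (fun w => _ + _) = fun w => b w * phi (Some w)).
  by rewrite nrm_act// bd mul1r.
by apply/funext => w; ring.
Qed.

Lemma nrmZ c x d : nrm (c *: x) d = nrm x d * `|c|.
Proof.
by rewrite -(actoo_cst N) nrm_actoo//; exact: (@cst_continuous opc R[i]^o).
Qed.

Lemma nrm0 d : nrm 0 d = 0.
Proof. by rewrite -(scale0r 0) nrmZ normr0 mulr0. Qed.

Lemma nrmN x d : nrm (- x) d = nrm x d.
Proof. by rewrite -scaleN1r nrmZ normrN1 mulr1. Qed.

Lemma nrm_eq0 x : (forall d, nrm x d = 0) -> x = 0.
Proof.
move=> x0; apply/normr0_eq0/le_anti; rewrite normr_ge0 andbT.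
by apply: norm_le_nrm => // d; rewrite x0.
Qed.

Lemma nrm_le_sub x y d : nrm x d <= nrm y d + nrm (x - y) d.
Proof. by rewrite -[in leLHS](subrK y x) addrC nrm_triangle. Qed.

Lemma KE_nrmP x (S : set X) :
  KE N (Some @` S) x <-> forall d, S d -> nrm x d = 0.
Proof.
split=> [Kx d Sd|x0].
  (* An element of the form y phi, with phi zero at [d], that is closer to [x] than [nrm x d]
     contradicts [nrm_le_norm]. *)
  apply: contrapT => /eqP nx; have {}nx : 0 < nrm x d by rewrite lt_def nx nrm_ge0.
  have [_ [[y [phi [[cphi phi0] ->]]]]] := Kx _ (nbhsx_ballx x _ nx).
  rewrite -ball_normE /= => /(le_lt_trans (nrm_le_norm _ d)).
  suff /le_lt_trans : nrm x d <= nrm (x - actoo N y phi) d.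
    by move=> /[apply]; rewrite ltxx.
  apply: (le_trans (nrm_le_sub x (actoo N y phi) d)).
  by rewrite nrm_actoo// phi0 ?normr0 ?mulr0 ?add0r//; exists d.
move=> U /nbhs_ballP[eps /= eps0 epsU].
pose r := complex.Re eps / 2.
have r0 : 0 < r by rewrite divr_gt0// -ltcR ge0_ReK// ltW.
have rC0 : 0 < r%:C by rewrite ltcR.
have reps : r%:C < eps.
  rewrite -[ltRHS](ge0_ReK (ltW eps0)) ltcR /r gtr_pMr ?invf_lt1 ?ltr1n//.
  by rewrite -ltcR ge0_ReK// ltW.
pose psi : opc -> R[i] := extend (nrm x) 0.
have psi0 (y : opc) : 0 <= psi y by case: y => [d|] //=; rewrite addr0 nrm_ge0.
have psir (y : opc) : 0 < psi y + r%:C by rewrite ltr_wpDl.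
have cpsi : continuous (psi : opc -> R[i]^o).
  by apply: extend_continuous; have [] := nrm_C0 x.
(* With t = |x|(d), the remainder x (1 - phi) has norm t r / (t + r) at [d], hence at most [r],
   while phi vanishes wherever |x| does. *)
pose phi (y : opc) := psi y / (psi y + r%:C).
have cphi : continuous (phi : opc -> R[i]^o).
  move=> y; apply: (@cvgM R[i] _ _ _ psi (fun z => (psi z + r%:C)^-1) _ _ (cpsi y)).
  apply: (@cvgV R[i] _ _ _ (fun z => psi z + r%:C)); first exact: lt0r_neq0.
  exact: (@cvgD _ R[i]^o _ _ _ _ _ _ _ (cpsi y) (cvg_cst _)).
exists (actoo N x phi); split.
  exists x, phi; split => //; split => // _ [d Sd <-].
  by rewrite /phi /psi /= x0// addr0 mul0r.
apply: epsU; rewrite -ball_normE /=; apply: le_lt_trans reps.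
apply: norm_le_nrm; first exact: ltW.
move=> d; rewrite -[x in x - _]scale1r -(actoo_cst N) actooB//; last first.
  exact: (@cst_continuous opc R[i]^o).
rewrite nrm_actoo; last first.
  by move=> y; exact: (cvgB (cvg_cst _) (cphi y)).
have nd := nrm_ge0 x d; have := psir (Some d); rewrite /phi /psi /= addr0 => nr.
have -> : 1 - nrm x d / (nrm x d + r%:C) = r%:C / (nrm x d + r%:C).
  by field; exact: lt0r_neq0.
rewrite ger0_norm; last by rewrite divr_ge0// ltW.
by rewrite mulrCA ler_piMr ?(ltW rC0)// ler_pdivrMr// mul1r lerDl ltW.
Qed.

Lemma KE1_nrmP x d : KE N [set Some d] x <-> nrm x d = 0.
Proof.
by rewrite -image_set1 KE_nrmP; split=> [|xd _ ->//]; exact.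
Qed.

End Normed.

(** Serves to bundle the linear maps that are constructed inside the main proof. *)
Lemma linear_bundle (K : pzRingType) (U V : lmodType K) (f : U -> V) :
  linear f -> exists g : {linear U -> V}, forall u, g u = f u.
Proof.
move=> lf; pose L := GRing.isLinear.Build _ _ _ _ f lf.
by pose g : {linear U -> V} := HB.pack f L; exists g.
Qed.

(** * Gliding hump for local maps, and its consequences *)

Section LocalMap.
Local Set Implicit Arguments.
Local Unset Strict Implicit.
Context {R : realType} {Omega Delta : topologicalType}.
Context {E F : completeNormedModType R[i]}.
Hypotheses (hausO : hausdorff_space Omega) (lcO : locally_compact [set: Omega]).
Hypotheses (hausD : hausdorff_space Delta) (lcD : locally_compact [set: Delta]).
Variables (M : c0module Omega E) (N : c0module Delta F).
Variable nrm : F -> Delta -> R[i].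
Hypotheses (nrm_C0 : forall x, C0 (nrm x) /\ (forall d, 0 <= nrm x d))
  (nrm_triangle : forall x y d, nrm (x + y) d <= nrm x d + nrm y d)
  (nrm_act : forall x a d, C0 a -> nrm (N x a) d = nrm x d * `|a d|)
  (norm_nrm : forall x, `|x| = (supnorm (nrm x))%:C).
Variable theta : {linear E -> F}.
Variable sigma : Dset N theta -> Omega.
Hypothesis sigma_inj : injective sigma.
Hypothesis sigma_loc : forall nu : Dset N theta,
  theta @` IE M (sigma nu) `<=` KE N [set Some (val nu)].
Local Notation opc := (one_point_compactification Omega).
Local Notation KE1P := (KE1_nrmP hausD lcD nrm_C0 nrm_triangle nrm_act norm_nrm).
Local Notation nrm_Z := (nrmZ hausD lcD nrm_act).
Local Notation nrm_N := (nrmN hausD lcD nrm_act).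
Local Notation nrm_0 := (nrm0 hausD lcD nrm_act).
Implicit Types (nu : Dset N theta) (e : E) (d : Delta).

Lemma nrm_theta_IE nu e : IE M (sigma nu) e -> nrm (theta e) (val nu) = 0.
Proof. by move=> Ie; apply/KE1P; apply: sigma_loc; exists e. Qed.

Lemma nrm_theta_Zset d e : ~ Dset N theta d -> nrm (theta e) d = 0.
Proof.
move=> nD; apply/KE1P/tilde_eq0; have : Zset N theta d.
  by apply: contrapT => nZ; apply: nD.
exact.
Qed.

Lemma nrm_sub_eq0 x y d : nrm x d = 0 -> nrm y d = 0 -> nrm (x - y) d = 0.
Proof.
move=> x0 y0; apply/le_anti; rewrite (nrm_ge0 nrm_C0) andbT.
by rewrite (le_trans (nrm_triangle _ _ _))// nrm_N x0 y0 addr0.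
Qed.

(** The bound is uniform in [nu] and [e]. Thanks to the finite exceptional set, failure of tameness
    provides bad points outside any given finite set. *)
Definition tame (U : set opc) := exists (T : set (Dset N theta)) (C : R),
  finite_set T /\ forall nu, U (Some (sigma nu)) -> ~ T nu ->
    forall e, nrm (theta e) (val nu) <= C%:C * `|e|.

Lemma not_tame (U : set opc) (T : set (Dset N theta)) (C : R) :
  ~ tame U -> finite_set T ->
  exists nu e, [/\ U (Some (sigma nu)), ~ T nu &
    ~ nrm (theta e) (val nu) <= C%:C * `|e|].
Proof.
move=> nU fT; apply: contrapT => H; apply: nU; exists T, C; split=> // nu Unu nT e.
by apply: contrapT => h; apply: H; exists nu, e.
Qed.

Lemma tameU (U V W : set opc) : tame U -> tame V -> W `<=` U `|` V -> tame W.
Proof.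
move=> [T [C [fT TC]]] [T' [C' [fT' TC']]] WUV.
exists (T `|` T'), (Num.max C C'); split; first by rewrite finite_setU.
move=> nu /WUV UVnu nT e; have [nT1 nT2] : ~ T nu /\ ~ T' nu.
  by split=> h; apply: nT; [left|right].
case: UVnu => h; [apply: (le_trans (TC _ h nT1 e))|apply: (le_trans (TC' _ h nT2 e))];
  by apply: ler_wpM2r => //; rewrite lecR le_max lexx ?orbT.
Qed.

(** Scale [e] to norm 2^-n; the factor 2^n in the hypothesis then leaves the bound [n]. *)
Lemma rescale n nu e :
  ~ nrm (theta e) (val nu) <= (n%:R * 2 ^+ n)%:C * `|e| ->
  exists x, `|x| <= (2^-1 ^+ n)%:C /\ n%:R%:C < nrm (theta x) (val nu).
Proof.
move=> /negP; rewrite -real_ltNge ?ger0_real ?(nrm_ge0 nrm_C0)//; last first.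
  by apply: mulr_ge0 => //; rewrite lecR mulr_ge0// exprn_ge0.
move=> big; have e0 : 0 < `|e|.
  rewrite lt_def normr_ge0 andbT normr_eq0; apply: contraTneq big => ->.
  by rewrite linear0 nrm_0 normr0 mulr0 ltxx.
have p0 : 0 < (2^-1 ^+ n)%:C :> R[i] by rewrite ltcR exprn_gt0// invr_gt0.
have c0 : 0 < (2^-1 ^+ n)%:C / `|e| by rewrite divr_gt0.
exists (((2^-1 ^+ n)%:C / `|e|) *: e); split.
  by rewrite normrZ gtr0_norm// divfK// gt_eqF.
rewrite linearZ nrm_Z gtr0_norm// mulrA ltr_pdivlMr//.
rewrite -ltr_pdivrMr//; apply: le_lt_trans big.
rewrite mulrAC ler_pM2r// ler_pdivrMr// -rmorphM/= lecR.
by rewrite -mulrA -exprMn mulfV// expr1n mulr1.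
Qed.

(* Of two distinct points where [theta] is large, removing small disjoint
   neighbourhoods one at a time cannot make both remainders tame. *)
Lemma gliding_step n (U : set opc) : open U -> ~ tame U ->
  exists nu x (W : set opc), [/\ nbhs (Some (sigma nu) : opc) W, closed W,
    W `<=` U, `|x| <= (2^-1 ^+ n)%:C /\ n%:R%:C < nrm (theta x) (val nu) &
    ~ tame (U `\` W)].
Proof.
move=> oU nU.
have [nu1 [e1 [U1 _ /rescale [x1 big1]]]] := not_tame (n%:R * 2 ^+ n) nU (finite_set0 _).
(* Declaring [nu1] exceptional forces a second, distinct bad point. *)
have [nu2 [e2 [U2 n12 /rescale [x2 big2]]]] :=
  not_tame (n%:R * 2 ^+ n) nU (finite_set1 nu1).
have ne : Some (sigma nu1) != Some (sigma nu2) :> opc.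
  by apply/eqP => -[/sigma_inj h]; apply: n12.
have := opc_hausdorff hausO lcO; rewrite open_hausdorff => /(_ _ _ ne).
move=> [[A1 A2] /= [/set_mem A1n /set_mem A2n] [oA1 oA2 A12]].
have [W1 [nW1 cW1 W1U]] := opc_closed_nbhs hausO lcO
  (open_nbhs_nbhs (conj (openI oA1 oU) (conj A1n U1))).
have [W2 [nW2 cW2 W2U]] := opc_closed_nbhs hausO lcO
  (open_nbhs_nbhs (conj (openI oA2 oU) (conj A2n U2))).
have [t1|nt1] := pselect (tame (U `\` W1)); last first.
  by exists nu1, x1, W1; split => // y /W1U [].
exists nu2, x2, W2; split => //; first by move=> y /W2U [].
move=> t2; apply: nU; apply: tameU t1 t2 _ => y Uy.
have [/W1U [A1y _]|] := pselect (W1 y); last by left.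
right; split=> // /W2U [A2y _].
by have : (A1 `&` A2) y by []; rewrite (eqP A12).
Qed.

Lemma tame_setT : tame setT.
Proof.
apply: contrapT => nT.
(* These are only default values, for the choice function at pairs to which [gliding_step] does not
   apply. *)
have [nu0 [e0 _]] := not_tame 0 nT (finite_set0 _).
pose spec (p : nat * set opc) (q : Dset N theta * E * set opc) :=
  open p.2 -> ~ tame p.2 ->
  [/\ nbhs (Some (sigma q.1.1) : opc) q.2, closed q.2, q.2 `<=` p.2,
    `|q.1.2| <= (2^-1 ^+ p.1)%:C /\ p.1%:R%:C < nrm (theta q.1.2) (val q.1.1) &
    ~ tame (p.2 `\` q.2)].
have /choice [f Hf] : forall p, exists q, spec p q.
  move=> [n U]; have [[oU tU]|nH] := pselect (open U /\ ~ tame U).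
    by have [nu [x [W H]]] := gliding_step n oU tU; exists (nu, x, W).
  by exists (nu0, e0, setT) => oU tU; exfalso; exact: nH.
(* [U n] is what remains after removing the first [n] chosen neighbourhoods, so later choices are
   disjoint from them. *)
pose U := fix U n := if n is m.+1 then U m `\` (f (m, U m)).2 else setT.
have HU n : open (U n) /\ ~ tame (U n).
  elim: n => [|n [oU tU]] /=; first by split; [exact: openT|].
  have [_ cW _ _ tW] := Hf (n, U n) oU tU; split => //.
  by apply: openI => //; exact: closed_openC.
have Uanti m n : (m <= n)%N -> U n `<=` U m.
  move=> /subnK <-; elim: (n - m)%N => [|k IH] //=.
  by move=> y [/IH].
pose q n := f (n, U n).
have Hq n : spec (n, U n) (q n) by exact: Hf.
have {Hf}Hq n := Hq n (HU n).1 (HU n).2.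
have dis m n : (m < n)%N -> (q m).2 `&` (q n).2 = set0.
  move=> mn; apply/disjoints_subset => y qm qn.
  have [_ _ /= sub _ _] := Hq n.
  by have [] := Uanti _ _ mn _ (sub _ qn).
have [e He] : exists e, forall n, IE M (sigma (q n).1.1) (e - (q n).1.2).
  apply: (@disjoint_glue _ _ _ M hausO lcO _ (fun n => (q n).2)).
  - by move=> n; have [] := Hq n.
  - move=> m n; rewrite neq_ltn => /orP[|]; first exact: dis.
    by rewrite setIC; exact: dis.
  - by move=> n; have [_ _ _ []] := Hq n.
pose B := complex.Re `|theta e|.
have B0 : 0 <= B by exact: Re_norm_ge0.
(* Locality makes |theta e| dominate |theta x_n| at nu_n, so the norm of theta e exceeds every
   integer. *)
have big n : n%:R < B.
  rewrite -ltcR [B%:C]ge0_ReK//; have [_ _ _ [_]] := Hq n.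
  move=> + _ => /lt_le_trans; apply; set nu := (q n).1.1; set x := (q n).1.2.
  apply: (le_trans (nrm_le_sub nrm_triangle (theta x) (theta e) (val nu))).
  rewrite -[X in _ + X <= _]nrm_N opprB -linearB (nrm_theta_IE (He n)) addr0.
  exact: nrm_le_norm.
have := big (Num.truncn B).+1; have := truncnS_gt B.
by move=> /lt_trans /[apply]; rewrite ltxx.
Qed.

(** In a Hausdorff space the other, finitely many, points of [G] form a closed set and can be
    removed. *)
Lemma isolated_of_finite_nbhs d (G : set Delta) :
  nbhs d G -> finite_set G -> isolated [set: Delta] d.
Proof.
move=> nG fG; split; first exact: mem_set.
exists (G `&` ~` (G `\ d)).
  apply: filterI => //; apply: open_nbhs_nbhs; split; last by move=> [_ /(_ erefl)].
  apply: closed_openC; apply: accessible_finite_set_closed.1 => //.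
    exact: hausdorff_accessible.
  exact: finite_setD.
apply/seteqP; split=> y /=.
  by move=> [[Gy nGy] _]; apply: contrapT => yd; apply: nGy.
move=> ->; split => //; split; first exact: nbhs_singleton nG.
by move=> [_ /(_ erefl)].
Qed.

Lemma nrm_theta_bounded : exists (T : {fset Dset N theta}) (C : R),
  [/\ 0 <= C, forall nu : T, isolated [set: Delta] (val (val nu)) &
    forall d e, ~ range (fun nu : T => val (val nu)) d ->
      nrm (theta e) d <= C%:C * `|e|].
Proof.
have [T0 [C [fT0 T0C]]] := tame_setT.
(* Only isolated exceptional points are kept. If the bound failed at some other [d], it would fail
   on a neighbourhood of [d] contained in the image of [T0], so [d] would be isolated. *)
pose S := T0 `&` [set nu | isolated [set: Delta] (val nu)].
have fS : finite_set S by exact: finite_setIl.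
exists (fset_set S), `|C|; split => //.
  by move=> [nu /= nuS]; move: nuS; rewrite in_fset_set// => /set_mem [].
move=> d e nd; apply: contrapT => /negP; rewrite -real_ltNge; last first.
- by rewrite ger0_real// (nrm_ge0 nrm_C0).
- by rewrite ger0_real// mulr_ge0// lecR.
set B := _ * _ => Bd.
have B0 : 0 <= B by rewrite mulr_ge0// lecR.
have nG : nbhs d [set t | B < nrm (theta e) t].
  have gap : 0 < nrm (theta e) d - B by rewrite subr_gt0.
  have [[cn _] _] := nrm_C0 (theta e).
  have /cvgrPdist_lt/(_ _ gap) := cn d; apply: filterS => t /= dt.
  have rdt : nrm (theta e) d - nrm (theta e) t \is Num.real.
    by rewrite rpredB// ger0_real// (nrm_ge0 nrm_C0).
  by have := le_lt_trans (real_ler_norm rdt) dt; rewrite ltrD2l ltrN2.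
have sub : [set t | B < nrm (theta e) t] `<=` val @` T0.
  move=> t /= Bt; have [Dt|nDt] := pselect (Dset N theta t); last first.
    by move: Bt; rewrite nrm_theta_Zset// => /(le_lt_trans B0); rewrite ltxx.
  exists (SigSub (mem_set Dt)) => //; apply: contrapT => nT.
  have := T0C (SigSub (mem_set Dt)) I nT e.
  move=> /(lt_le_trans Bt) /lt_le_trans /(_ (ler_wpM2r (normr_ge0 e) _)).
  by move=> /(_ `|C|%:C); rewrite lecR ler_norm ltxx => /(_ isT).
have [nu T0nu nud] := sub _ (nbhs_singleton nG).
apply: nd.
have nuS : nu \in fset_set S.
  rewrite in_fset_set//; apply: mem_set; split => //=; rewrite nud.
  apply: (isolated_of_finite_nbhs nG); apply: sub_finite_set sub _.
  exact: finite_image.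
by exists [` nuS]%fset.
Qed.

Hypothesis sigma_iso : forall nu,
  isolated (Dset N theta) (val nu) -> isolated [set: Omega] (sigma nu).

Lemma sigma_isolated nu :
  isolated [set: Delta] (val nu) -> isolated [set: Omega] (sigma nu).
Proof.
move=> [_ [V nV]]; rewrite setIT => VE; apply: sigma_iso.
split; first exact: valP.
exists V => //; rewrite VE; apply/seteqP; split=> [x []|x ->] //.
by split=> //; exact: set_valP.
Qed.

Lemma nrm_theta_KE nu e :
  KE M [set Some (sigma nu)] e -> nrm (theta e) (val nu) = 0.
Proof.
move=> Ke; have [T [C [C_ge0 Tiso TC]]] := nrm_theta_bounded.
have [[mu _ munu]|nT] := pselect (range (fun mu : T => val (val mu)) (val nu)).
  (* Here the singleton of [sigma nu] is itself a compact neighbourhood, so K^E and I^E coincide at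
     this point. *)
  have [_ [V nV]] : isolated [set: Omega] (sigma nu).
    by apply: sigma_isolated; rewrite -munu; exact: Tiso.
  rewrite setIT => VE; apply: nrm_theta_IE.
  exists [set Some (sigma nu)]; split => //; last exact: compact_set1.
  rewrite -image_set1 -VE; exact: one_point_compactification_some_nbhs.
apply: contrapT => /eqP ne0.
have {}ne0 : 0 < nrm (theta e) (val nu) by rewrite lt_def ne0 (nrm_ge0 nrm_C0).
pose a := complex.Re (nrm (theta e) (val nu)).
have aE : a%:C = nrm (theta e) (val nu) by rewrite ge0_ReK// ltW.
have a0 : 0 < a by rewrite -ltcR aE.
have C10 : 0 < C + 1 by rewrite ltr_wpDl.
(* At distance below a / (C + 1) the bound gives a value strictly less than [a], also when [C] =
   0. *)
have [u [Iu eu]] := IE_dense hausO lcO Ke (divr_gt0 a0 C10).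
have := nrm_le_sub nrm_triangle (theta e) (theta u) (val nu).
rewrite (nrm_theta_IE Iu) add0r -linearB => /le_trans /(_ (TC _ _ nT)).
apply/negP; rewrite -real_ltNge; last 2 first.
- by rewrite ger0_real// mulr_ge0// lecR.
- exact: gtr0_real.
apply: (@le_lt_trans _ _ (C%:C * (a / (C + 1))%:C)).
  by apply: ler_wpM2l; [rewrite lecR|exact: ltW].
rewrite -aE -rmorphM/= ltcR mulrCA gtr_pMr// ltr_pdivrMr// mul1r.
by rewrite ltrDl.
Qed.

(** Compare pointwise norms: at [val nu] both sides agree with [theta e], and at any other point
    both vanish, the left one because [sigma] is injective. *)
Lemma theta_act_indic nu e : isolated [set: Delta] (val nu) ->
  theta (M e \1_[set sigma nu]) = N (theta e) \1_[set val nu].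
Proof.
move=> iD; have iO := sigma_isolated iD.
have Ci := C0_indic hausO iO.
apply/eqP; rewrite -subr_eq0; apply/eqP.
apply: (nrm_eq0 nrm_C0 norm_nrm) => d.
have [->|/eqP dnu] := eqVneq d (val nu).
  rewrite (_ : _ - _ = theta e - N (theta e) \1_[set val nu] -
      theta (e - M e \1_[set sigma nu])).
    by apply: nrm_sub_eq0; [apply/KE1P|apply: nrm_theta_KE]; exact: KE_sub_act_indic.
  by rewrite linearB opprB [RHS]addrC addrA subrK.
apply: nrm_sub_eq0; last first.
  rewrite nrm_act; last exact: C0_indic.
  by rewrite indicE memNset// normr0 mulr0.
have [Dd|nD] := pselect (Dset N theta d); last exact: nrm_theta_Zset.
rewrite -[d]/(val (SigSub (mem_set Dd) : Dset N theta)).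
apply: nrm_theta_KE.
rewrite -[M _ _]addr0 -[0](scale0r e) -actoo_extend//.
apply: KE_actoo; split; first exact: extend_continuous.
move=> _ -> /=; rewrite addr0 indicE memNset// => /= /sigma_inj h.
by apply: dnu; rewrite -h.
Qed.

End LocalMap.

(** * Boundedness and the direct sum decomposition of the local map *)

Theorem theorem3p7 (R : realType) (Omega Delta : topologicalType)
    (hausO : hausdorff_space Omega) (lcO : locally_compact [set: Omega])
    (hausD : hausdorff_space Delta) (lcD : locally_compact [set: Delta])
    (E F : completeNormedModType R[i])
    (M : c0module Omega E) (N : c0module Delta F) (normedN : is_c0normed N)
    (theta : {linear E -> F})
    (sigma : Dset N theta -> Omega) (sigma_inj : injective sigma)
    (sigma_loc : forall nu : Dset N theta,
       theta @` IE M (sigma nu) `<=` KE N [set Some (val nu)]) :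
  (isolated [set: Delta] = set0 -> bounded_map theta) /\
  ((forall nu : Dset N theta,
      isolated (Dset N theta) (val nu) ->
      isolated [set: Omega] (sigma nu)) ->
   Nset M sigma = set0 /\
   exists (T : {fset Dset N theta})
     (theta0 :
        {linear restr M (~` range (fun nu : T => sigma (val nu))) ->
                restr N (~` range (fun nu : T => val (val nu)))})
     (theta_ : forall nu : T,
        {linear fibre M (sigma (val nu)) -> fibre N (val (val nu))}),
     [/\ forall nu : T, isolated [set: Delta] (val (val nu)),
         exists C : R, forall x,
           `|restr_emb (theta0 x)| <= C%:C * `|restr_emb x|,
         bijective (@dsum_emb R Omega E M T (fun nu : T => sigma (val nu))),
         bijective (@dsum_emb R Delta F N T (fun nu : T => val (val nu))) &
         forall (x : restr M (~` range (fun nu : T => sigma (val nu))))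
           (xi : forall nu : T, fibre M (sigma (val nu))),
           theta (dsum_emb (x, xi)) =
           dsum_emb (theta0 x, fun nu : T => theta_ nu (xi nu))]).
Proof.
have [nrm [nrm_C0 nrm_triangle nrm_act norm_nrm]] := normedN.
have [T [C [C_ge0 Tiso TC]]] :=
  nrm_theta_bounded hausO lcO hausD lcD nrm_C0 nrm_triangle nrm_act norm_nrm
    sigma_inj sigma_loc.
(* Used twice: with [S] empty for (a), where [T] has no elements, and with [S] the image of [T] for
   the bound on [theta0]. *)
have bound x (S : set Delta) : (forall d, S d -> nrm (theta x) d = 0) ->
    range (fun nu : T => val (val nu)) `<=` S ->
    `|theta x| <= C%:C * `|x|.
  move=> S0 TS; rewrite -(ge0_ReK (normr_ge0 x)) -rmorphM/=.
  apply: (norm_le_nrm nrm_C0 norm_nrm) => [|d].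
    by rewrite mulr_ge0// Re_norm_ge0.
  rewrite rmorphM/= ge0_ReK//.
  have [/TS Sd|/TC //] := pselect (range (fun nu : T => val (val nu)) d).
  by rewrite S0// mulr_ge0// lecR.
split=> [iso0|sigma_iso].
  exists C => e; apply: (@bound e set0) => // _ [nu _ <-].
  by have := Tiso nu; rewrite iso0.
have thetaKE nu e : KE M [set Some (sigma nu)] e -> nrm (theta e) (val nu) = 0.
  exact: (nrm_theta_KE hausO lcO hausD lcD nrm_C0 nrm_triangle nrm_act norm_nrm
    sigma_inj sigma_loc sigma_iso).
have KE1P := KE1_nrmP hausD lcD nrm_C0 nrm_triangle nrm_act norm_nrm.
have KEP := KE_nrmP hausD lcD nrm_C0 nrm_triangle nrm_act norm_nrm.
split.
  apply/seteqP; split=> // nu; apply => _ [e Ke <-].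
  by apply/KE1P; exact: thetaKE.
(* The first summand of E lies in K^E at each sigma(nu) with nu in [T], so [theta] maps it into the
   first summand of F. *)
have nrm_restr (x : restr M (~` range (fun nu : T => sigma (val nu)))) d :
    range (fun nu : T => val (val nu)) d -> nrm (theta (restr_emb x)) d = 0.
  move=> [nu _ <-]; apply: thetaKE; have /asboolP := svalP x.
  by apply: KE_subset => _ ->; exists (sigma (val nu)) => //; rewrite setCK; exists nu.
have theta_mem (x : restr M (~` range (fun nu : T => sigma (val nu)))) :
    theta (restr_emb x) \in
      KEpred N (Some @` ~` ~` range (fun nu : T => val (val nu))).
  by rewrite mem_KEpred setCK; apply/asboolP/KEP => d; exact: nrm_restr.
have [theta0 theta0E] : exists theta0 :
    {linear restr M (~` range (fun nu : T => sigma (val nu))) ->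
            restr N (~` range (fun nu : T => val (val nu)))},
    forall x, restr_emb (theta0 x) = theta (restr_emb x).
  pose f x : restr N (~` range (fun nu : T => val (val nu))) :=
    exist (fun y => is_true (y \in KEpred N _)) _ (theta_mem x).
  have lf : linear f.
    by move=> c x y; apply: val_inj; rewrite /= /restr_emb /= linearP.
  by have [g gE] := linear_bundle _ _ _ _ lf; exists g => x; rewrite gE.
have theta_ex (nu : T) : exists theta_nu :
    {linear fibre M (sigma (val nu)) -> fibre N (val (val nu))},
    forall xi, fibre_emb (theta_nu xi) = theta (fibre_emb xi).
  pose w := sigma (val nu); pose v := val (val nu).
  have iv : isolated [set: Delta] v := Tiso nu.
  pose h (xi : fibre M w) : fibre N v := tilde N (theta (repr xi)) v.
  have reprK (xi : fibre M w) : tilde M (repr xi) w = xi by exact: KEclass_repr.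
  (* Independence of the representative: two of them differ by an element of K^E_w, which [theta]
     sends into K^F_v. *)
  have hE e : h (tilde M e w) = tilde N (theta e) v.
    apply/tilde_eqP/KE1P; rewrite -linearB; apply/thetaKE/tilde_eqP.
    exact: reprK.
  have lh : linear h.
    move=> c x y; rewrite -[x in LHS]reprK -[y in LHS]reprK -tilde_linear hE.
    by rewrite linearP tilde_linear.
  have [g gE] := linear_bundle _ _ _ _ lh; exists g => xi.
  (* The embedded class of theta(repr xi) is its product with chi_v, and [theta] intertwines chi_w
     with chi_v. *)
  rewrite gE /h fibre_embE// -(theta_act_indic hausO lcO hausD lcD
    nrm_C0 nrm_triangle nrm_act norm_nrm sigma_inj sigma_loc sigma_iso)//.
exists T, theta0, (fun nu => projT1 (cid (theta_ex nu))); split => //.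
- exists C => x; rewrite theta0E.
  apply: (bound _ (range (fun nu : T => val (val nu)))) => // d.
  exact: nrm_restr.
- apply: dsum_emb_bij => // [x y /sigma_inj/val_inj //|nu].
  exact: (sigma_isolated sigma_iso).
- by apply: dsum_emb_bij => // x y /val_inj/val_inj.
move=> x xi; rewrite /dsum_emb linearD linear_sum theta0E; congr (_ + _).
apply: eq_bigr => nu _ /=; case: cid => g /= gE; by rewrite gE.
Qed.
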